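(* Let $d,m,n\in\mathbb{N}$, let $\mathbf{A}\in(\mathcal{S}'(\mathbb{Z}^d))^{m\times n}$ and $\mathbf{b}\in(\mathcal{S}'(\mathbb{Z}^d))^{m\times 1}$. Then the following two statements are equivalent: (1) There exists an $\mathbf{x}\in(\mathcal{S}'(\mathbb{Z}^d))^{n\times 1}$ such that $\mathbf{A}\mathbf{x}=\mathbf{b}$. (2) There exist a $\delta>0$ and a $k>0$ such that for all $\mathbf{n}\in\mathbb{Z}^d$ and all $y\in\mathbb{C}^m$, $$\|(\mathbf{A}(\mathbf{n}))^{*}y\|_2\ \ge\ \delta\,(1+|\mathbf{n}|_1)^{-k}\,|\langle y,\mathbf{b}(\mathbf{n})\rangle_2|.$$
   Context: $\mathbb{N}=\{1,2,3,\dots\}$. For $\mathbf{n}=(n_1,\dots,n_d)\in\mathbb{Z}^d$ write $|\mathbf{n}|_1:=|n_1|+\cdots+|n_d|$. The set $\mathcal{S}'(\mathbb{Z}^d)$ consists of all maps $\mathbf{a}:\mathbb{Z}^d\to\mathbb{C}$ of at most polynomial growth, i.e. such that there exist a real $M>0$ and $k\in\mathbb{N}$ with $|\mathbf{a}(\mathbf{n})|\le M(1+|\mathbf{n}|_1)^k$ for all $\mathbf{n}\in\mathbb{Z}^d$. With pointwise addition and multiplication it is a commutative unital ring. For a matrix $\mathbf{A}$ over $\mathcal{S}'(\mathbb{Z}^d)$, $\mathbf{A}(\mathbf{n})$ denotes the complex matrix obtained by evaluating each entry at $\mathbf{n}$, and $(\mathbf{A}(\mathbf{n}))^*$ is its conjugate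 transpose. $\langle\cdot,\cdot\rangle_2$ is the usual Euclidean inner product on $\mathbb{C}^m$ (or $\mathbb{C}^n$) and $\|\cdot\|_2$ the induced norm. *)

(* Defs.v *)
From HB Require Import structures.
From mathcomp Require Import all_boot all_order all_algebra.
From mathcomp Require Import complex.
From mathcomp Require Import all_classical all_reals exp.

Set Implicit Arguments.
Unset Strict Implicit.
Unset Printing Implicit Defensive.

Import Order.TTheory GRing.Theory Num.Theory.

Local Open Scope ring_scope.
Local Open Scope complex_scope.
Local Open Scope sesquilinear_scope.

Definition znorm1 (d : nat) (p : 'rV[int]_d) : nat :=
  (\sum_(i < d) `|p 0%R i|)%N.

(* The left-hand side is a modulus, hence a real element of R[i], so that the
   order of R[i] restricts here to the order of R. *)
Definition poly_growth (R : realType) (d : nat) (a : 'rV[int]_d -> R[i]) :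
    Prop :=
  exists (M : R) (k : nat), 0 < M /\ (0 < k)%N /\
    forall p, `|a p| <= (M * (1 + (znorm1 p)%:R) ^+ k)%:C.

Definition tempered (R : realType) (d : nat) :
    {pred ('rV[int]_d -> R[i])} :=
  fun a => `[< poly_growth a >].

Lemma tempered_subring (R : realType) (d : nat) :
  subring_closed (@tempered R d).
Proof.
have E (a : 'rV[int]_d -> R[i]) :
  (a \in @tempered R d) = `[< poly_growth a >] by [].
have base (p : 'rV[int]_d) : 1 <= 1 + (znorm1 p)%:R :> R.
  by rewrite lerDl ler0n.
have lift (M N : R) k l p : 0 < M -> M <= N -> (k <= l)%N ->
    (M * (1 + (znorm1 p)%:R) ^+ k)%:C
      <= (N * (1 + (znorm1 (p : 'rV[int]_d))%:R) ^+ l)%:C :> R[i].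
  move=> M0 MN kl; rewrite lecR; apply: ler_pM => //; first exact: ltW.
    by rewrite exprn_ge0 // (le_trans _ (base p)).
  by rewrite ler_weXn2l.
split.
- rewrite E; apply/asboolP; exists 1, 1%N; split => //; split => // p.
  by rewrite normr1 mul1r expr1 lecR.
- move=> a b; rewrite !E => /asboolP[M [k [M0 [k0 Ha]]]].
  move=> /asboolP[N [l [N0 [l0 Hb]]]]; apply/asboolP.
  exists (M + N), (maxn k l); split; first exact: addr_gt0.
  split; first by rewrite leq_max k0.
  move=> p; apply: le_trans (ler_normB _ _) _.
  rewrite mulrDl rmorphD /= lerD //.
    by apply: le_trans (Ha p) _; apply: lift; rewrite // leq_maxl.
  by apply: le_trans (Hb p) _; apply: lift; rewrite // leq_maxr.
- move=> a b; rewrite !E => /asboolP[M [k [M0 [k0 Ha]]]].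
  move=> /asboolP[N [l [N0 [l0 Hb]]]]; apply/asboolP.
  exists (M * N), (k + l)%N; split; first exact: mulr_gt0.
  split; first by rewrite addn_gt0 k0.
  move=> p; rewrite [(a * b) p]/(a p * b p) normrM exprD mulrACA rmorphM /=.
  by rewrite ler_pM.
Qed.

HB.instance Definition _ (R : realType) (d : nat) :=
  GRing.isSubringClosed.Build ('rV[int]_d -> R[i]) (@tempered R d)
    (@tempered_subring R d).

Record slow_growth (R : realType) (d : nat) := SlowGrowth {
  slow_fun :> 'rV[int]_d -> R[i];
  _ : slow_fun \in @tempered R d }.

HB.instance Definition _ (R : realType) (d : nat) :=
  [isSub for @slow_fun R d].
HB.instance Definition _ (R : realType) (d : nat) :=
  [Choice of slow_growth R d by <:].
HB.instance Definition _ (R : realType) (d : nat) :=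
  GRing.SubChoice_isSubComPzRing.Build ('rV[int]_d -> R[i]) _
    (slow_growth R d) (GRing.subringClosedP (@tempered R d)).

Definition evalmx (R : realType) (d m n : nat) (A : 'M[slow_growth R d]_(m, n))
    (p : 'rV[int]_d) : 'M[R[i]]_(m, n) :=
  map_mx (fun a : slow_growth R d => a p) A.

Definition inner2 (R : realType) (m : nat) (u v : 'cV[R[i]]_m) : R[i] :=
  dotmx u^T v^T.

Definition norm2 (R : realType) (m : nat) (u : 'cV[R[i]]_m) : R[i] :=
  sqrtC (inner2 u u).

(* Main.v *)
(** The ring equation [A x = b] holds iff it holds at every lattice point, so
    everything reduces to a quantitative linear algebra statement at one point:
    [M x = b] has a solution of norm at most [1/c] as soon as
    [c |<y, b>| <= |M^* y|] for all [y].  Indeed the bound makes [b] orthogonal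
    to the kernel of [M^*], which is the kernel of [M M^*], hence
    [b = M M^* z]; taking [y := z] the bound reads [c |M^* z|^2 <= |M^* z|], so
    that [x := M^* z] has norm at most [1/c]. *)

Require Import Defs.
From HB Require Import structures.
From mathcomp Require Import all_boot all_order all_algebra.
From mathcomp Require Import complex.
From mathcomp Require Import all_classical all_reals exp.

Set Implicit Arguments.
Unset Strict Implicit.
Unset Printing Implicit Defensive.

Import Order.TTheory GRing.Theory Num.Theory.

Local Open Scope ring_scope.
Local Open Scope complex_scope.
Local Open Scope sesquilinear_scope.

Section LinearAlgebra.
Variable R : realType.
Implicit Types m n : nat.

Lemma inner2E m (u v : 'cV[R[i]]_m) :
  inner2 u v = (u^T *m map_mx Num.conj v) 0 0.
Proof. by rewrite /inner2 dotmxE trmxK. Qed.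

Lemma inner2_sum m (u v : 'cV[R[i]]_m) :
  inner2 u v = \sum_i u i 0 * (v i 0)^*%R.
Proof. by rewrite inner2E mxE; apply: eq_bigr => i _; rewrite !mxE. Qed.

Lemma inner2_adjoint m n (M : 'M[R[i]]_(m, n)) u v :
  inner2 (M^t* *m u) v = inner2 u (M *m v).
Proof. by rewrite !inner2E trmx_mul map_mxM map_trmx trmxK mulmxA. Qed.

Lemma inner2_ge0 m (u : 'cV[R[i]]_m) : 0 <= inner2 u u.
Proof.
by rewrite inner2_sum sumr_ge0 // => i _; rewrite mul_conjC_ge0.
Qed.

Lemma inner2_eq0 m (u : 'cV[R[i]]_m) : inner2 u u = 0 -> u = 0.
Proof.
move=> u0; apply: trmx_inj; rewrite trmx0; apply/eqP; apply/negPn/negP.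
by move=> /dotmx_is_dotmx; rewrite -/(inner2 u u) u0 ltxx.
Qed.

Lemma norm2_ge0 m (u : 'cV[R[i]]_m) : 0 <= norm2 u.
Proof. by rewrite sqrtC_ge0 inner2_ge0. Qed.

Lemma le_coord_norm2 m (u : 'cV[R[i]]_m) i : `|u i 0| <= norm2 u.
Proof.
rewrite -(@ler_pXn2r _ 2) ?nnegrE ?norm2_ge0 // sqrtCK normCK inner2_sum.
by rewrite (bigD1 i) //= lerDl sumr_ge0 // => j _; rewrite mul_conjC_ge0.
Qed.

(** A crude form of Cauchy-Schwarz, from [|u_i| <= norm2 u]. The sum of moduli of [v] is convenient
    because tempered functions are closed under finite sums. *)
Lemma inner2_le_norm2_sum m (u v : 'cV[R[i]]_m) :
  `|inner2 u v| <= norm2 u * \sum_i `|v i 0|.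
Proof.
rewrite inner2_sum (le_trans (ler_norm_sum _ _ _)) // mulr_sumr ler_sum // => i _.
by rewrite normrM norm_conjC ler_wpM2r // le_coord_norm2.
Qed.

(** By adjunction the squared norm of [M^t* *m y] is the inner product of [y] with
    [M *m M^t* *m y]. *)
Lemma ker_mul_adjoint m n (M : 'M[R[i]]_(m, n)) (y : 'cV_m) :
  M *m M^t* *m y = 0 -> M^t* *m y = 0.
Proof.
move=> y0; apply: inner2_eq0.
by rewrite inner2_adjoint mulmxA y0 inner2E map_mx0 mulmx0 mxE.
Qed.

(** [M *m M^t*] is Hermitian, so its range is the orthogonal complement of its kernel, which is the
    kernel of [M^t*]. *)
Lemma range_mul_adjoint m n (M : 'M[R[i]]_(m, n)) (b : 'cV_m) :
  (forall y, M^t* *m y = 0 -> inner2 y b = 0) ->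
  exists z, b = M *m M^t* *m z.
Proof.
move=> kerb; set G := (M *m M^t*)^T.
suff /submxP[z bz] : (b^T <= G)%MS.
  by exists z^T; rewrite -[LHS]trmxK bz trmx_mul trmxK.
(* It remains to see that [b^T] kills each column [c] of the cokernel of [G]. Since [G *m c = 0],
   the conjugate of [c] lies in the kernel of [M *m M^t*], hence is orthogonal to [b]; conjugating
   that relation gives the claim. *)
rewrite submxE; apply/eqP/matrixP => i j; rewrite ord1 [RHS]mxE.
pose c := col j (cokermx G).
have Gconj : map_mx Num.conj G = M *m M^t*.
  apply/matrixP => k l; rewrite !mxE rmorph_sum; apply: eq_bigr => s _.
  by rewrite !mxE rmorphM /= conjCK mulrC.
have /ker_mul_adjoint/kerb : M *m M^t* *m map_mx Num.conj c = 0.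
  by rewrite -Gconj -map_mxM /c colE mulmxA mulmx_coker mul0mx map_mx0.
rewrite inner2_sum => /(congr1 Num.conj); rewrite rmorph_sum rmorph0 /= => s0.
rewrite mxE -[RHS]s0; apply: eq_bigr => k _.
by rewrite !mxE rmorphM /= !conjCK mulrC.
Qed.

Lemma bounded_solution m n (M : 'M[R[i]]_(m, n)) (b : 'cV_m) (c : R) :
  0 < c -> (forall y, c%:C * `|inner2 y b| <= norm2 (M^t* *m y)) ->
  exists x, M *m x = b /\ norm2 x <= (c^-1)%:C.
Proof.
move=> c0 lb; have cC0 : 0 < c%:C :> R[i] by rewrite ltcR.
have [y y0|z bz] := @range_mul_adjoint _ _ M b.
  apply/eqP; rewrite -normr_le0 -(pmulr_rle0 _ cC0).
  rewrite (le_trans (lb y)) // y0 /norm2 inner2E trmx0 mul0mx mxE.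
  by rewrite sqrtC0.
exists (M^t* *m z); split; first by rewrite mulmxA -bz.
have := lb z; rewrite bz -mulmxA -inner2_adjoint ger0_norm ?inner2_ge0 //.
rewrite -[inner2 _ _]sqrtCK -/(norm2 _) expr2 mulrA.
(* The inequality is now [c * N * N <= N] with [N] the norm of the solution; [N = 0] is treated
   apart so that [N] can be cancelled. *)
have := norm2_ge0 (M^t* *m z); rewrite le_eqVlt => /predU1P[<- _|N0].
  by rewrite ler0c invr_ge0 ltW.
by rewrite -ler_pdivlMr // divff ?gt_eqF // mulrC -ler_pdivlMr // mul1r fmorphV.
Qed.

End LinearAlgebra.

Section SlowGrowth.
Variables (R : realType) (d : nat).

Lemma evalmxM m n l (A : 'M[slow_growth R d]_(m, n))
    (B : 'M[slow_growth R d]_(n, l)) p :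
  evalmx (A *m B) p = evalmx A p *m evalmx B p.
Proof.
apply/matrixP => i j; rewrite !mxE -[slow_fun _]/(val _) raddf_sum fct_sumE.
by apply: eq_bigr => k _; rewrite !mxE.
Qed.

Lemma evalmx_inj m n (A B : 'M[slow_growth R d]_(m, n)) :
  (forall p, evalmx A p = evalmx B p) -> A = B.
Proof.
move=> AB; apply/matrixP => i j; apply: val_inj; apply/funext => p /=.
by have /matrixP/(_ i j) := AB p; rewrite !mxE.
Qed.

Lemma temperedP (a : 'rV[int]_d -> R[i]) :
  reflect (poly_growth a) (a \in @tempered R d).
Proof. exact: asboolP. Qed.

Lemma poly_growth_sum_norm n (x : 'cV[slow_growth R d]_n) :
  poly_growth (fun p => \sum_i `|evalmx x p i 0|).
Proof.
apply/temperedP.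
have -> : (fun p => \sum_i `|evalmx x p i 0|) =
          \sum_i (fun p : 'rV[int]_d => `|evalmx x p i 0|).
  by rewrite fct_sumE.
apply: rpred_sum => i _; apply/temperedP.
have : slow_fun (x i 0) \in @tempered R d := valP (x i 0).
move=> /temperedP[M [k [M0 [k0 Hx]]]].
by exists M, k; split=> //; split=> // p; rewrite normr_id mxE.
Qed.

End SlowGrowth.

Theorem theorem9p1 (R : realType) (d m n : nat)
    (hd : (0 < d)%N) (hm : (0 < m)%N) (hn : (0 < n)%N)
    (A : 'M[slow_growth R d]_(m, n)) (b : 'cV[slow_growth R d]_m) :
  (exists x : 'cV[slow_growth R d]_n, A *m x = b)
  <->
  (exists delta k : R, 0 < delta /\ 0 < k /\
     forall (p : 'rV[int]_d) (y : 'cV[R[i]]_m),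
       norm2 ((evalmx A p)^t* *m y)
         >= (delta * (1 + (znorm1 p)%:R) `^ (- k))%:C
              * `|inner2 y (evalmx b p)|).
Proof.
have base_gt0 (p : 'rV[int]_d) : 0 < 1 + (znorm1 p)%:R :> R.
  by rewrite ltr_wpDr.
have base_ge0 p := ltW (base_gt0 p).
split=> [[x <-]|[delta [k [delta0 [k0 lb]]]]].
  have [M [k [M0 [k0 Mk]]]] := poly_growth_sum_norm x.
  (* [M] and [k] bound the sum of the moduli of the coordinates of [x], the factor lost when
     estimating the inner product of [A^* y] with [x]. *)
  exists M^-1, k%:R; rewrite invr_gt0 ltr0n; split=> //; split=> // p y.
  have W0 : 0 < M * (1 + (znorm1 p)%:R) ^+ k by rewrite mulr_gt0 ?exprn_gt0.
  rewrite powRN powR_mulrn // -invfM fmorphV /= mulrC.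
  rewrite ler_pdivrMr ?ltcR // evalmxM -inner2_adjoint.
  apply: le_trans (inner2_le_norm2_sum _ _) _.
  rewrite ler_wpM2l ?norm2_ge0 // (le_trans _ (Mk p)) //.
  by rewrite ger0_norm // sumr_ge0.
have c_gt0 p : 0 < delta * (1 + (znorm1 (p : 'rV[int]_d))%:R) `^ (- k).
  by rewrite mulr_gt0 ?powR_gt0.
(* Solutions at different lattice points can be chosen independently: only their growth is
   constrained. *)
have /choice[x xP] p := bounded_solution (c_gt0 p) (lb p).
have x_growth j : (fun p => x p j 0) \in @tempered R d.
  (* The norm bound is [delta^-1 * (1 + |p|_1) ^ k] with [k] real; as the base is at least 1, [k]
     may be raised to a natural exponent. *)
  apply/temperedP; exists delta^-1, (Num.bound k).
  have kK := archi_boundP (ltW k0).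
  split; first by rewrite invr_gt0.
  split=> [|p]; first by rewrite -(ltr0n R) (lt_trans k0 kK).
  have [_ xp] := xP p; rewrite (le_trans (le_coord_norm2 _ _)) ?(le_trans xp) //.
  rewrite lecR invfM powRN invrK ler_pM2l ?invr_gt0 //.
  by rewrite -powR_mulrn // ler_powR ?lerDl ?(ltW kK).
exists (\col_j SlowGrowth (x_growth j)).
apply: evalmx_inj => p; rewrite evalmxM; have [<- _] := xP p; congr (_ *m _).
by apply/matrixP => i j; rewrite ord1 !mxE.
Qed.
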